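(* Let $N\ge1$ and $T\in\mathcal{M}_N(\mathbb{R})$. Then $T$ fails to be orbit reflexive if and only if $T$ is similar to a matrix $T'\in\mathcal{M}_N(\mathbb{R})$ which is not orbit reflexive and which is of the form $$T'=R_{\theta_1}\oplus\cdots\oplus R_{\theta_k}\oplus B\oplus C$$ with $k\in\mathbb{N}$ ($k\ge 1$), $\theta_1,\ldots,\theta_k\in[0,2\pi)$, $B$ a real square matrix with $B^2=I$, and $C$ a real square matrix with $r(C)<1$ (either or both of the summands $B$ and $C$ may be absent).
   Context: For $T\in\mathcal{M}_N(\mathbb{R})$, acting on $\mathbb{R}^N$, let $\mathrm{Orb}(T)=\{T^n: n\ge 0\}$ and $\mathrm{Orb}(T)x=\{T^nx:n\ge0\}$. Let $\mathrm{OrbRef}(T)$ be the set of all $S\in\mathcal{M}_N(\mathbb{R})$ such that $Sx$ lies in the closure of $\mathrm{Orb}(T)x$ for every $x\in\mathbb{R}^N$. $T$ is orbit reflexive if $\mathrm{OrbRef}(T)$ equals the closure of $\mathrm{Orb}(T)$ in $\mathcal{M}_N(\mathbb{R})$. $R_\theta=\begin{pmatrix}\cos\theta&-\sin\theta\\ \sin\theta&\cos\theta\end{pmatrix}$, and $r(C)=\lim_{n\to\infty}\|C^n\|^{1/n}$ is the spectral radius of $C$ viewed as a complex matrix. *)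

(* Defs.v *)
From mathcomp Require Export all_boot all_order all_algebra.
From mathcomp Require Export complex.
From mathcomp Require Export all_classical all_reals all_analysis.

Set Implicit Arguments.
Unset Strict Implicit.
Unset Printing Implicit Defensive.

Import Order.TTheory GRing.Theory Num.Theory.
Import numFieldNormedType.Exports.

Local Open Scope classical_set_scope.
Local Open Scope ring_scope.

Definition Orb (R : realType) (N : nat) (T : 'M[R]_N) : set 'M[R]_N :=
  [set T ^+ n | n in [set: nat]].

Definition Orb_at (R : realType) (N : nat) (T : 'M[R]_N) (x : 'cV[R]_N) :
    set 'cV[R]_N :=
  [set T ^+ n *m x | n in [set: nat]].

Definition OrbRef (R : realType) (N : nat) (T : 'M[R]_N) : set 'M[R]_N :=
  [set S | forall x : 'cV[R]_N, closure (Orb_at T x) (S *m x)].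

Definition orbit_reflexive (R : realType) (N : nat) (T : 'M[R]_N) : Prop :=
  OrbRef T = closure (Orb T).

Definition rotation (R : realType) (t : R) : 'M[R]_2 :=
  \matrix_(i < 2, j < 2)
    if i == j then cos t else if i == 0 then - sin t else sin t.

Definition mx_dsum (R : realType) (m n : nat) (A : 'M[R]_m) (B : 'M[R]_n) :
    'M[R]_(m + n) :=
  block_mx A 0 0 B.

(* [`|A|] is the largest modulus of an entry of [A], a complex number with zero
   imaginary part.  The limit below exists and is the same for every norm on
   the complex m x m matrices; it is 0 when m = 0. *)
Definition spectral_radius (R : realType) (m : nat) (A : 'M[R[i]]_m) : R :=
  lim ((complex.Re `|A ^+ n|) `^ (n%:R^-1) @[n --> \oo]).

(* The summands of dimension p = 0 or q = 0 are the absent ones. *)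
Definition rotation_involution_contraction_form (R : realType) (N : nat)
    (T : 'M[R]_N) : Prop :=
  exists (k p q : nat) (theta : 'I_k -> R) (B : 'M[R]_p) (C : 'M[R]_q)
    (e : (\sum_(i < k) 2 + p + q)%N = N),
  [/\ (1 <= k)%N,
      forall i, 0 <= theta i < 2 * pi,
      B ^+ 2 = 1%:M,
      spectral_radius (map_mx (real_complex R) C) < 1
    & T = castmx (e, e)
            (mx_dsum (mx_dsum (\mxdiag_(i < k) rotation (theta i)) B) C)].

(* Main.v *)
(* If T has an eigenvalue of modulus > 1, or a nontrivial Jordan block at an
   eigenvalue of modulus 1, then off a proper subspace all orbits tend to
   infinity, hence are closed.  For S in OrbRef(T) this covers the space by
   countably many subspaces {x | S x = T^n x} and one proper subspace, and a
   real vector space is not a countable union of proper subspaces: S = T^n.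
   Otherwise every eigenvalue of modulus 1 has a left and a right eigenvector
   with nonzero pairing, which splits off a rotation block (nonreal eigenvalue)
   or a 1 x 1 block with entry 1 or -1 (real eigenvalue) until the remaining
   block C has all eigenvalues in the open unit disk.  If no rotation was split
   off, the orbit of x accumulates only at (B + 0)x and (I + 0)x, and
   the covering argument shows again that T is orbit reflexive. *)

Require Import Defs.
From mathcomp Require Import ring lra.
From mathcomp Require polyrcf.
Set Implicit Arguments.
Unset Strict Implicit.
Unset Printing Implicit Defensive.

Import Order.TTheory GRing.Theory Num.Theory.
Import numFieldNormedType.Exports.

Local Open Scope classical_set_scope.
Local Open Scope ring_scope.

(** * Similarity and block decompositions *)

(* Similarity across dimensions that are only provably equal. *)
Definition mx_iso (F : fieldType) (m n : nat) (A : 'M[F]_m) (B : 'M[F]_n) :=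
  exists (P : 'M[F]_(m, n)) (Q : 'M[F]_(n, m)),
    [/\ P *m Q = 1%:M, Q *m P = 1%:M & A *m P = P *m B].

Section MxIso.
Variable F : fieldType.

Lemma mx_iso_refl (m : nat) (A : 'M[F]_m) : mx_iso A A.
Proof. by exists 1%:M, 1%:M; rewrite !mulmx1 mul1mx. Qed.

Lemma mx_iso_sym (m n : nat) (A : 'M[F]_m) (B : 'M[F]_n) :
  mx_iso A B -> mx_iso B A.
Proof.
move=> [P [Q [PQ QP AP]]]; exists Q, P; split=> //.
have : Q *m (A *m P) *m Q = Q *m (P *m B) *m Q by rewrite AP.
by rewrite !mulmxA QP mul1mx -(mulmxA _ P) PQ mulmx1.
Qed.

Lemma mx_iso_trans (m n p : nat) (A : 'M[F]_m) (B : 'M[F]_n) (C : 'M[F]_p) :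
  mx_iso A B -> mx_iso B C -> mx_iso A C.
Proof.
move=> [P [Q [PQ QP AP]]] [P' [Q' [PQ' QP' BP]]]; exists (P *m P'), (Q' *m Q).
split.
- by rewrite mulmxA -(mulmxA P) PQ' mulmx1.
- by rewrite mulmxA -(mulmxA Q') QP mulmx1.
- by rewrite mulmxA AP -mulmxA BP mulmxA.
Qed.

Lemma mx_iso_size (m n : nat) (A : 'M[F]_m) (B : 'M[F]_n) :
  mx_iso A B -> m = n.
Proof.
by move=> [P [Q [PQ QP _]]]; apply/eqP; rewrite eqn_leq (mulmx1_min PQ)
  (mulmx1_min QP).
Qed.

Lemma mx_iso_simmx (n : nat) (A B : 'M[F]_n) :
  mx_iso A B <-> A ~_{in unitmx} B.
Proof.
split=> [/mx_iso_sym [P [Q [PQ QP BP]]]|[P Pu /(simmxP Pu) PA]].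
  have Pu : P \in unitmx by case: (mulmx1_unit PQ).
  by exists P => //; apply/(simmxP Pu).
by apply: mx_iso_sym; exists P, (invmx P); rewrite mulmxV ?mulVmx.
Qed.

Lemma mx_iso_cast (m n : nat) (e : m = n) (A : 'M[F]_m) :
  mx_iso A (castmx (e, e) A).
Proof. by case: n / e; rewrite castmx_id; apply: mx_iso_refl. Qed.

Lemma mx_iso_block (m1 m2 n1 n2 : nat) (A1 : 'M[F]_m1) (A2 : 'M[F]_m2)
    (B1 : 'M[F]_n1) (B2 : 'M[F]_n2) :
  mx_iso A1 B1 -> mx_iso A2 B2 ->
  mx_iso (block_mx A1 0 0 A2) (block_mx B1 0 0 B2).
Proof.
move=> [P [Q [PQ QP AP]]] [P' [Q' [PQ' QP' AP']]].
exists (block_mx P 0 0 P'), (block_mx Q 0 0 Q').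
by split; rewrite !mulmx_block !mulmx0 !mul0mx !addr0 !add0r ?PQ ?PQ' ?QP ?QP'
  ?AP ?AP' -?scalar_mx_block.
Qed.

Lemma mx_iso_blockA (m n p : nat) (A : 'M[F]_m) (B : 'M[F]_n) (C : 'M[F]_p) :
  mx_iso (block_mx A 0 0 (block_mx B 0 0 C))
         (block_mx (block_mx A 0 0 B) 0 0 C).
Proof.
have := @block_mxA _ m n p m n p A 0 0 0 B 0 0 0 C.
by rewrite /= !row_mx0 !col_mx0 => ->; apply/mx_iso_sym/mx_iso_cast.
Qed.

(** The size is a variable with a proof that it vanishes, because it also arises as an empty sum of
    block sizes. *)
Lemma mx_iso_block0 (m n : nat) (A : 'M[F]_m) (B : 'M[F]_n) :
  m = 0 -> mx_iso (block_mx A 0 0 B) B.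
Proof.
move=> m0; case: _ / (esym m0) in A *; rewrite block_mxEv col_flat_mx row_thin_mx.
exact: mx_iso_refl.
Qed.

(** The left kernel of [W] is stable under [A] because [A *m W = W *m D], and [V *m W = 1%:M] makes
    it a complement of the row span of [V], on which [A] acts by [D]. *)
Lemma mx_iso_split (k n : nat) (A : 'M[F]_n) (D : 'M[F]_k)
    (V : 'M[F]_(k, n)) (W : 'M[F]_(n, k)) :
  V *m W = 1%:M -> V *m A = D *m V -> A *m W = W *m D ->
  exists m (A' : 'M[F]_m), mx_iso A (block_mx D 0 0 A').
Proof.
move=> VW VA AW; pose K := row_base (kermx W).
have KW : K *m W = 0 by apply/sub_kermxP; rewrite eq_row_base.
have [A' KA] : exists A', K *m A = A' *m K.
  apply/submxP; rewrite eq_row_base; apply/sub_kermxP.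
  by rewrite -mulmxA AW mulmxA KW mul0mx.
(* [1%:M - W *m V] projects onto the left kernel of [W] along the rows of [V]; [L] records its
   coordinates in the basis [K]. *)
have [L LE] : exists L, 1%:M - W *m V = L *m K.
  apply/submxP; rewrite eq_row_base; apply/sub_kermxP.
  by rewrite mulmxBl mul1mx -mulmxA VW mulmx1 subrr.
have KL : K *m L = 1%:M.
  have Kf : row_free K by apply: row_base_free.
  apply: (row_free_inj Kf).
  by rewrite -mulmxA -LE mulmxBr mulmx1 mulmxA KW mul0mx subr0 mul1mx.
have VL : V *m L = 0.
  have Kf : row_free K by apply: row_base_free.
  apply: (row_free_inj Kf).
  by rewrite -mulmxA -LE mulmxBr mulmx1 mulmxA VW mul1mx subrr mul0mx.
exists (\rank (kermx W)), A'; apply: mx_iso_sym.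
exists (col_mx V K), (row_mx W L); split.
- by rewrite mul_col_row VW KW KL VL -scalar_mx_block.
- by rewrite mul_row_col -LE addrC subrK.
- by rewrite mul_block_col mul_col_mx VA KA !mul0mx addr0 add0r.
Qed.

Lemma mx_iso_expr (m n : nat) (A : 'M[F]_m) (B : 'M[F]_n)
    (P : 'M[F]_(m, n)) (k : nat) :
  A *m P = P *m B -> A ^+ k *m P = P *m B ^+ k.
Proof.
move=> AP; elim: k => [|k IH]; first by rewrite !expr0 mul1mx mulmx1.
by rewrite !exprS -!mulmxE -mulmxA IH mulmxA AP -mulmxA.
Qed.

Lemma block_diag_expr (m n : nat) (A : 'M[F]_m) (B : 'M[F]_n) (k : nat) :
  block_mx A 0 0 B ^+ k = block_mx (A ^+ k) 0 0 (B ^+ k).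
Proof.
elim: k => [|k IH]; first by rewrite !expr0 -scalar_mx_block.
by rewrite !exprS IH -!mulmxE mulmx_block !mulmx0 !mul0mx !addr0 !add0r.
Qed.

End MxIso.

Lemma mx_iso_map (F K : fieldType) (f : {rmorphism F -> K}) (m n : nat)
    (A : 'M[F]_m) (B : 'M[F]_n) :
  mx_iso A B -> mx_iso (map_mx f A) (map_mx f B).
Proof.
move=> [P [Q [PQ QP AP]]]; exists (map_mx f P), (map_mx f Q).
by rewrite -!map_mxM PQ QP AP !map_mx1.
Qed.

Lemma map_mx_expr (F K : pzRingType) (f : {rmorphism F -> K}) (n : nat)
    (A : 'M[F]_n) (k : nat) :
  map_mx f (A ^+ k) = map_mx f A ^+ k.
Proof.
elim: k => [|k IH]; first by rewrite !expr0 map_mx1.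
by rewrite !exprS -!mulmxE map_mxM IH.
Qed.

(** * Topology of matrix spaces *)

Lemma closure_distP (R : realType) (V : normedModType R) (A : set V) (y : V) :
  closure A y <-> forall e : R, 0 < e -> exists2 a, A a & `|y - a| < e.
Proof.
split=> [Ay e e0|Ay U].
  have [a [Aa]] := Ay _ (nbhsx_ballx y e e0).
  by rewrite -ball_normE; exists a.
move=> /nbhs_ballP [e /= e0 eU]; have [a Aa ya] := Ay e e0.
by exists a; split=> //; apply: eU; rewrite -ball_normE.
Qed.

(** If [y] is no term of the sequence, its distances to the first [N] terms have a positive minimum,
    so any closer term has index at least [N]. *)
Lemma closure_range_cases (R : realType) (V : normedModType R) (z : nat -> V)
    (y : V) :
  closure (range z) y ->
  (exists n, y = z n) \/
  forall (e : R) (N : nat), 0 < e -> exists2 n, (N <= n)%N & `|y - z n| < e.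
Proof.
move=> /closure_distP zy.
have [//|nz] := pselect (exists n, y = z n); first by left.
right=> e N e0; pose d := \big[Order.min/e]_(i < N) `|y - z i|.
have d0 : 0 < d.
  apply: lt_bigmin => // i _; rewrite normr_gt0 subr_eq0.
  by apply/eqP => yz; apply: nz; exists i.
have [_ [n _ <-] yzn] := zy d d0.
exists n; first last.
  by apply: lt_le_trans yzn _; rewrite /d bigmin_idl ge_min lexx.
rewrite leqNgt; apply/negP => nN; move: yzn; rewrite ltNge => /negP; apply.
by rewrite /d (bigD1 (Ordinal nN)) //= ge_min lexx.
Qed.

(* The points (1, t, ..., t^(N-1)) meet each hyperplane in finitely many
   parameters [t], and [R] is uncountable. *)
Lemma countable_hyperplanes_avoid (R : realType) (N : nat)
    (r : nat -> 'rV[R]_N) :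
  (forall j, r j != 0) -> exists x : 'cV[R]_N, forall j, r j *m x != 0.
Proof.
move=> r0; pose p j := rVpoly (r j).
have p0 j : p j != 0.
  by apply: contra_neq (r0 j) => pj; rewrite -[r j]rVpolyK -/(p j) pj linear0.
pose A := \bigcup_j [set t | root (p j) t].
have cA : countable A.
  apply: bigcup_countable => // j _; apply: finite_set_countable.
  have := @polyrcf.roots_on_rootsR _ _ (p0 j).
  set s := polyrcf.rootsR _ => ps.
  apply: (sub_finite_set _ (finite_seq s)) => t /= pt.
  by rewrite -ps pt in_itv.
have [t At] : exists t, ~ A t.
  apply/existsNP => AT.
  (* Uncountability is obtained from measure: a countable set is null, the whole line is not. *)
  have : lebesgue_measure A = 0%E := countable_lebesgue_measure0 cA.
  have -> : A = [set` Interval -oo%O +oo%O].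
    by apply/seteqP; split=> t // _; apply: AT.
  by rewrite lebesgue_measure_itv.
exists (\col_i t ^+ i) => j; apply/eqP => rx; apply: At; exists j => //=.
rewrite /root (horner_coef_wide _ (size_poly _ _)).
have /matrixP /(_ 0 0) := rx; rewrite !mxE => rx0; apply/eqP; rewrite -[RHS]rx0.
by apply: eq_bigr => i _; rewrite mxE coef_rVpoly_ord.
Qed.

(** * Maximum norm of matrices *)

Section MatrixNorm.
Variable K : numFieldType.

Lemma mx_entry_le_norm (m n : nat) (A : 'M[K]_(m, n)) (i : 'I_m) (j : 'I_n) :
  `|A i j| <= `|A|.
Proof.
rewrite [leRHS]/Num.Def.normr /= mx_normE.
have -> : `|A i j| = (`|A i j|%:nng)%:num by [].
by rewrite num_le; apply/bigmax_geP; right; exists (i, j).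
Qed.

Lemma mx_norm_le (m n : nat) (A : 'M[K]_(m, n)) (c : K) :
  0 <= c -> (forall i j, `|A i j| <= c) -> `|A| <= c.
Proof.
move=> c0 Ac; rewrite [leLHS]/Num.Def.normr /=.
have [/eqP -> //|A0] := boolP (mx_norm A == 0).
by have [[i j] /= ->] := mx_norm_neq0 A0.
Qed.

Lemma mulmx_norm_le (m n p : nat) (A : 'M[K]_(m, n)) (B : 'M[K]_(n, p)) :
  `|A *m B| <= n%:R * `|A| * `|B|.
Proof.
apply: mx_norm_le => [|i j]; first by rewrite !mulr_ge0.
rewrite mxE (le_trans (ler_norm_sum _ _ _)) //.
rewrite -mulrA mulr_natl -[X in _ *+ X]card_ord -sumr_const.
by apply: ler_sum => k _; rewrite normrM ler_pM // mx_entry_le_norm.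
Qed.

End MatrixNorm.

(** * Criteria for orbit reflexivity *)

Lemma closure_lipschitz (R : realType) (V W : normedModType R) (f : V -> W)
    (k : R) (A : set V) (B : set W) (y : V) :
  (forall a b, `|f a - f b| <= k * `|a - b|) ->
  (forall a, A a -> B (f a)) -> closure A y -> closure B (f y).
Proof.
move=> fk AB /closure_distP Ay; apply/closure_distP => e e0.
have k0 : 0 < `|k| + 1 by rewrite ltr_wpDl.
have [a Aa ya] := Ay (e / (`|k| + 1)) (divr_gt0 e0 k0).
exists (f a); first exact: AB.
apply: le_lt_trans (fk _ _) _; rewrite ltr_pdivlMr // mulrC in ya.
by apply: le_lt_trans ya; rewrite ler_wpM2r // (le_trans (ler_norm _)) // lerDl.
Qed.

Section OrbitReflexive.
Variable R : realType.

Lemma closure_mulmxl (m n p : nat) (M : 'M[R]_(m, n)) (A : set 'M[R]_(n, p))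
    (B : set 'M[R]_(m, p)) (y : 'M[R]_(n, p)) :
  (forall a, A a -> B (M *m a)) -> closure A y -> closure B (M *m y).
Proof.
apply: (closure_lipschitz (k := n%:R * `|M|)) => a b.
by rewrite -mulmxBr mulmx_norm_le.
Qed.

Lemma closure_mulmxr (m n p : nat) (M : 'M[R]_(n, p)) (A : set 'M[R]_(m, n))
    (B : set 'M[R]_(m, p)) (y : 'M[R]_(m, n)) :
  (forall a, A a -> B (a *m M)) -> closure A y -> closure B (y *m M).
Proof.
apply: (closure_lipschitz (f := mulmx^~ M) (k := n%:R * `|M|)) => a b.
by rewrite -mulmxBl (le_trans (mulmx_norm_le _ _)) // mulrAC.
Qed.

(** Evaluation at [x] is continuous, so the closure of [Orb T] always lies in [OrbRef T]. *)
Lemma orbit_reflexiveP (n : nat) (T : 'M[R]_n) :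
  orbit_reflexive T <-> OrbRef T `<=` closure (Orb T).
Proof.
split=> [-> //|sT]; apply/seteqP; split=> // S TS x.
by apply: closure_mulmxr TS => _ [k _ <-]; exists k.
Qed.

(** Passing from [S] to [P *m S *m Q] carries [OrbRef B] into [OrbRef A], and the inverse
    conjugation carries the closure of [Orb A] into that of [Orb B]. *)
Lemma orbit_reflexive_iso (m n : nat) (A : 'M[R]_m) (B : 'M[R]_n) :
  mx_iso A B -> orbit_reflexive A -> orbit_reflexive B.
Proof.
move=> [P [Q [PQ QP AP]]] /orbit_reflexiveP rA; apply/orbit_reflexiveP => S BS.
have AS : closure (Orb A) (P *m S *m Q).
  apply: rA => x; rewrite -!mulmxA.
  apply: closure_mulmxl (BS (Q *m x)) => _ [k _ <-]; exists k => //.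
  by rewrite -[x in LHS]mul1mx -PQ -(mulmxA P) !mulmxA (mx_iso_expr k AP).
have -> : S = Q *m (P *m S *m Q *m P).
  by rewrite -!mulmxA QP mulmx1 mulmxA QP mul1mx.
rewrite mulmxA; apply: (closure_mulmxr (A := [set Q *m a | a in Orb A])).
  move=> _ [_ [k _ <-] <-]; exists k => //.
  by rewrite -mulmxA (mx_iso_expr k AP) mulmxA QP mul1mx.
by apply: closure_mulmxl AS => a; exists a.
Qed.

(* For [S] in [OrbRef T] the subspaces [{x | v x = 0}] and [{x | S x = M j x}]
   cover the space, so one of them is the whole space. *)
Lemma orbit_reflexive_countable (n : nat) (T : 'M[R]_n) (M : nat -> 'M[R]_n)
    (v : 'rV[R]_n) :
  v != 0 -> (forall j, closure (Orb T) (M j)) ->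
  (forall (x y : 'cV[R]_n), v *m x != 0 -> closure (Orb_at T x) y ->
     exists j, y = M j *m x) ->
  orbit_reflexive T.
Proof.
move=> v0 TM Mx; apply/orbit_reflexiveP => S TS.
have [[j ->] //|SM] := pselect (exists j, S = M j).
(* Index 0 carries [v], index [j + 1] a nonzero row of [S - M j]; this row would vanish at [x] if
   [S x = M j x]. *)
pose r j := if j is j'.+1 then nz_row (S - M j') else v.
have r0 j : r j != 0.
  case: j => [//|j]; rewrite nz_row_eq0 subr_eq0.
  by apply/eqP => Sj; apply: SM; exists j.
have [x rx] := countable_hyperplanes_avoid r0.
have [j Sx] := Mx x _ (rx 0) (TS x).
have /submxP [u rE] := nz_row_sub (S - M j).
by have := rx j.+1; rewrite /= rE -mulmxA mulmxBl Sx subrr mulmx0 eqxx.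
Qed.

Lemma involution_expr (n : nat) (B : 'M[R]_n) (k : nat) :
  B ^+ 2 = 1%:M -> B ^+ k = B ^+ odd k.
Proof.
move=> B2; rewrite -[in LHS](odd_double_half k) exprD -mul2n exprM B2.
by rewrite expr1n mulr1.
Qed.

Lemma dsum_norm (m n : nat) (C : 'M[R]_n) :
  `|block_mx (0 : 'M[R]_m) 0 0 C| <= `|C|.
Proof.
apply: mx_norm_le => // i j; rewrite block_mxEv !mxE.
by case: splitP => i' _; rewrite mxE; case: splitP => j' _; rewrite ?mxE ?normr0
  ?mx_entry_le_norm.
Qed.

(** The distance from [T ^+ n] to [L n] tends to 0 and [L] takes two values only, so these two
    matrices and the powers of [T] form the countable family of the covering argument. *)
Lemma orbit_reflexive_involution_contraction (p q : nat) (B : 'M[R]_p)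
    (C : 'M[R]_q) :
  (0 < p + q)%N -> B ^+ 2 = 1%:M ->
  (forall e : R, 0 < e -> exists N, forall n, (N <= n)%N -> `|C ^+ n| < e) ->
  orbit_reflexive (mx_dsum B C).
Proof.
move=> pq B2 C0; set T := mx_dsum B C.
pose L (n : nat) := mx_dsum (B ^+ odd n) (0 : 'M[R]_q).
have TL (n : nat) : `|T ^+ n - L n| <= `|C ^+ n|.
  rewrite /T /L /mx_dsum block_diag_expr opp_block_mx add_block_mx.
  by rewrite (involution_expr n B2) !subr0 subrr dsum_norm.
pose M j := if j is j'.+2 then T ^+ j' else L j.
apply: (@orbit_reflexive_countable _ _ M (const_mx 1)).
- apply/eqP => /matrixP /(_ 0 (Ordinal pq)); rewrite !mxE => /eqP.
  by rewrite oner_eq0.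
- move=> j; have Lj (k : nat) : closure (Orb T) (L k).
    apply/closure_distP => e e0; have [N CN] := C0 e e0.
    (* The exponent is at least [N] and has the parity of [k]. *)
    exists (T ^+ (N.*2 + k)); first by exists (N.*2 + k)%N.
    rewrite distrC; apply: le_lt_trans (CN (N.*2 + k)%N _); last first.
      by rewrite -addnn -addnA leq_addr.
    by have := TL (N.*2 + k)%N; rewrite /L oddD odd_double.
  case: j => [|[|j]]; [exact: Lj 0|exact: Lj 1|].
  by apply: subset_closure; exists j.
move=> x y _ /closure_range_cases [[j ->]|ycl]; first by exists j.+2.
have [->|y0] := eqVneq y (L 0 *m x); first by exists 0.
have [->|y1] := eqVneq y (L 1 *m x); first by exists 1.
(* Half the smaller distance from [y] to the two possible limits: a late orbit point within [e] of
   [y] and within [e] of [L n *m x] is then impossible. *)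
exfalso; pose e := Order.min `|y - L 0 *m x| `|y - L 1 *m x| / 2.
have e0 : 0 < e by rewrite divr_gt0 // lt_min !normr_gt0 !subr_eq0 y0 y1.
have k0 : 0 < (p + q)%:R * `|x| + 1 by rewrite ltr_wpDl // mulr_ge0.
have [N CN] := C0 (e / ((p + q)%:R * `|x| + 1)) (divr_gt0 e0 k0).
have [n Nn yn] := ycl e N e0.
have : `|y - L n *m x| < e + e.
  have -> : y - L n *m x = (y - T ^+ n *m x) + (T ^+ n - L n) *m x.
    by rewrite mulmxBl addrA subrK.
  apply: le_lt_trans (ler_normD _ _) _; apply: ltrD => //.
  have := CN n Nn; rewrite ltr_pdivlMr //; apply: le_lt_trans.
  apply: le_trans (mulmx_norm_le _ _) _; rewrite mulrAC mulrC.
  by rewrite ler_pM ?mulr_ge0 // lerDl.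
rewrite -splitr -/e /L; apply/negP; rewrite -leNgt.
by case: (odd n); rewrite ge_min ?lexx ?orbT.
Qed.

End OrbitReflexive.

(** * Matrices with generically divergent orbits *)

(* In the second alternative [u], [v] is a Jordan chain; in the first one [u] is
   irrelevant. *)
Definition expansive (K : numFieldType) (n : nat) (A : 'M[K]_n) :=
  exists (l : K) (u v : 'rV[K]_n),
    [/\ v != 0, v *m A = l *: v &
        1 < `|l| \/ (`|l| = 1 /\ u *m A = l *: u + v)].

Lemma bernoulli_le (K : numFieldType) (t : K) (n : nat) :
  1 <= t -> n%:R * (t - 1) <= t ^+ n.
Proof.
move=> t1; have t0 : 0 <= t - 1 by rewrite subr_ge0.
(* The extra summand 1 is what the induction needs. *)
suff : 1 + n%:R * (t - 1) <= t ^+ n by apply: le_trans; rewrite lerDr.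
elim: n => [|n IH]; first by rewrite mul0r addr0 expr0.
have -> : 1 + n.+1%:R * (t - 1) = t + n%:R * (t - 1) by rewrite -natr1; ring.
rewrite exprS; apply: le_trans (ler_wpM2l (le_trans ler01 t1) IH).
by rewrite [leRHS]mulrDr mulr1 lerD2l ler_peMl // mulr_ge0.
Qed.

(** A linear lower bound serves both alternatives: for [1 < |l|] it follows from Bernoulli's
    inequality, for a Jordan chain with [|l| = 1] from the coefficient of [v] in [u *m A ^+ k],
    which has modulus [k]. *)
Lemma expansive_growth (K : numFieldType) (n : nat) (A : 'M[K]_n) :
  expansive A -> exists (v w : 'rV[K]_n) (a : K),
    [/\ v != 0, 0 < a & forall x : 'cV[K]_n, exists b : K, forall k,
      k%:R * (a * `|v *m x|) <= `|w *m (A ^+ k *m x)| + b].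
Proof.
move=> [l [u [v [v0 vA lA]]]].
have vAk k : v *m A ^+ k = l ^+ k *: v.
  elim: k => [|k IH]; first by rewrite !expr0 mulmx1 scale1r.
  by rewrite exprS -mulmxE mulmxA vA -scalemxAl IH scalerA -exprS.
case: lA => [l1|[l1 uA]].
  exists v, v, (`|l| - 1); split; rewrite ?subr_gt0 // => x; exists 0 => k.
  rewrite addr0 mulmxA vAk -scalemxAl normrZ normrX mulrA ler_wpM2r //.
  by rewrite bernoulli_le // ltW.
have uAk k : u *m A ^+ k.+1 = l ^+ k.+1 *: u + (k.+1%:R * l ^+ k) *: v.
  elim: k => [|k IH]; first by rewrite !expr1 expr0 mulr1 scale1r.
  rewrite exprSr -mulmxE mulmxA IH mulmxDl -!scalemxAl uA vA scalerDr !scalerA.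
  rewrite -exprSr -addrA -scalerDl -[X in _ + (_ + X) *: _]mulrA -exprSr.
  by rewrite -[k.+2%:R]nat1r mulrDl mul1r.
exists v, u, 1; split=> // x; exists `|u *m x| => -[|k].
  by rewrite mul0r addr_ge0.
rewrite mul1r mulmxA uAk mulmxDl -!scalemxAl.
set a := l ^+ k.+1 *: _; set b := (_ * _) *: _.
have -> : k.+1%:R * `|v *m x| = `|b|.
  by rewrite normrZ normrM normrX l1 expr1n mulr1 normr_nat.
have -> : `|u *m x| = `|a| by rewrite normrZ normrX l1 expr1n mul1r.
by rewrite -[b in leLHS](addrK a) (addrC b) ler_normB.
Qed.

(** * Real and imaginary parts; closed orbits of expansive matrices *)

Section RealToComplex.
Variable R : realType.
Local Notation toC := (map_mx (real_complex R)).
Local Notation ReM := (map_mx (@complex.Re R)).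
Local Notation ImM := (map_mx (@complex.Im R)).

Lemma ReM_mul (m n p : nat) (A : 'M[R[i]]_(m, n)) (B : 'M[R[i]]_(n, p)) :
  ReM (A *m B) = ReM A *m ReM B - ImM A *m ImM B.
Proof.
apply/matrixP => i j; rewrite !mxE -sumrB.
rewrite (big_morph (@complex.Re R) (id1 := 0) (op1 := +%R)) //;
  last by case=> [? ?] [].
by apply: eq_bigr => k _; rewrite !mxE; case: (A i k) => a b; case: (B k j).
Qed.

Lemma ImM_mul (m n p : nat) (A : 'M[R[i]]_(m, n)) (B : 'M[R[i]]_(n, p)) :
  ImM (A *m B) = ReM A *m ImM B + ImM A *m ReM B.
Proof.
apply/matrixP => i j; rewrite !mxE -big_split /=.
rewrite (big_morph (@complex.Im R) (id1 := 0) (op1 := +%R)) //;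
  last by case=> [? ?] [].
by apply: eq_bigr => k _; rewrite !mxE; case: (A i k) => a b; case: (B k j).
Qed.

Lemma ReM_scale (m n : nat) (z : R[i]) (A : 'M[R[i]]_(m, n)) :
  ReM (z *: A) = complex.Re z *: ReM A - complex.Im z *: ImM A.
Proof. by apply/matrixP => i j; rewrite !mxE; case: z (A i j) => ? ? []. Qed.

Lemma ImM_scale (m n : nat) (z : R[i]) (A : 'M[R[i]]_(m, n)) :
  ImM (z *: A) = complex.Re z *: ImM A + complex.Im z *: ReM A.
Proof. by apply/matrixP => i j; rewrite !mxE; case: z (A i j) => ? ? []. Qed.

Lemma ReM_toC (m n : nat) (A : 'M[R]_(m, n)) : ReM (toC A) = A.
Proof. by apply/matrixP => i j; rewrite !mxE. Qed.

Lemma ImM_toC (m n : nat) (A : 'M[R]_(m, n)) : ImM (toC A) = 0.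
Proof. by apply/matrixP => i j; rewrite !mxE. Qed.

Lemma ReM_mulmxr (m n p : nat) (A : 'M[R[i]]_(m, n)) (B : 'M[R]_(n, p)) :
  ReM (A *m toC B) = ReM A *m B.
Proof. by rewrite ReM_mul ReM_toC ImM_toC mulmx0 subr0. Qed.

Lemma ImM_mulmxr (m n p : nat) (A : 'M[R[i]]_(m, n)) (B : 'M[R]_(n, p)) :
  ImM (A *m toC B) = ImM A *m B.
Proof. by rewrite ImM_mul ReM_toC ImM_toC mulmx0 add0r. Qed.

Lemma ReM_mulmxl (m n p : nat) (A : 'M[R]_(m, n)) (B : 'M[R[i]]_(n, p)) :
  ReM (toC A *m B) = A *m ReM B.
Proof. by rewrite ReM_mul ReM_toC ImM_toC mul0mx subr0. Qed.

Lemma ImM_mulmxl (m n p : nat) (A : 'M[R]_(m, n)) (B : 'M[R[i]]_(n, p)) :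
  ImM (toC A *m B) = A *m ImM B.
Proof. by rewrite ImM_mul ReM_toC ImM_toC mul0mx addr0. Qed.

Lemma complex_mx_eq0 (m n : nat) (A : 'M[R[i]]_(m, n)) :
  ReM A = 0 -> ImM A = 0 -> A = 0.
Proof.
move=> /matrixP A1 /matrixP A2; apply/matrixP => i j.
by have := A1 i j; have := A2 i j; rewrite !mxE; case: (A i j) => a b /= -> ->.
Qed.

Lemma toC_norm_le (m n : nat) (A : 'M[R]_(m, n)) : `|toC A| <= (`|A|)%:C%C.
Proof.
apply: mx_norm_le => [|i j]; first by rewrite ler0c.
by rewrite mxE normc_def /= expr0n addr0 sqrtr_sqr lecR mx_entry_le_norm.
Qed.

(** In the partial order of [R[i]], [a] is a positive real and a comparison with [c] forces the one
    of real parts, where the Archimedean property applies. *)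
Lemma nat_mul_unbounded (a c : R[i]) :
  0 < a -> exists N, forall n, (N <= n)%N -> ~ n%:R * a <= c.
Proof.
rewrite ltcE /= => /andP [/eqP a0 a1].
exists (Num.bound (complex.Re c / complex.Re a)).+1 => n nN.
rewrite lecE => /andP [_]; have -> : n%:R = (n%:R : R)%:C%C by rewrite rmorph_nat.
have -> : complex.Re (n%:R%:C%C * a) = n%:R * complex.Re a.
  by case: (a) => x y /=; rewrite mul0r subr0.
rewrite -ler_pdivlMr // leNgt => /negP; apply.
have [c0|c0] := lerP 0 (complex.Re c / complex.Re a).
  by apply: lt_le_trans (archi_boundP c0) _; rewrite ler_nat ltnW.
by apply: lt_le_trans c0 _.
Qed.

Lemma expansive_orbit_reflexive (n : nat) (T : 'M[R]_n) :
  expansive (toC T) -> orbit_reflexive T.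
Proof.
move=> /expansive_growth [v [w [a [v0 a0 vw]]]].
suff far (x y : 'cV[R]_n) :
    v *m toC x != 0 -> closure (Orb_at T x) y -> exists k, y = T ^+ k *m x.
  have TT k : closure (Orb T) (T ^+ k) by apply: subset_closure; exists k.
  (* The covering criterion needs a real row: the real or the imaginary part of [v] is nonzero, and
     where it does not vanish neither does [v]. *)
  have [v1|v1] := eqVneq (ReM v) 0; last first.
    apply: (orbit_reflexive_countable v1 TT) => x y vx; apply: far.
    by apply: contra_neq vx => vx; rewrite -ReM_mulmxr vx; apply/matrixP => i j; rewrite !mxE.
  have v2 : ImM v != 0 by apply: contra_neq v0; apply: complex_mx_eq0.
  apply: (orbit_reflexive_countable v2 TT) => x y vx; apply: far.
  by apply: contra_neq vx => vx; rewrite -ImM_mulmxr vx; apply/matrixP => i j; rewrite !mxE.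
move=> vx /closure_range_cases [//|ycl]; exfalso.
have [b wx] := vw (toC x).
have vx0 : 0 < a * `|v *m toC x| by rewrite mulr_gt0 ?normr_gt0.
(* A point [T ^+ k *m x] within 1 of [y] has its value under [w] bounded by [|w y| + n |w|], which
   linear growth rules out for large [k]. *)
have [N wN] := nat_mul_unbounded (`|w *m toC y| + n%:R * `|w| + b) vx0.
have [k Nk yk] := ycl 1 N ltr01.
apply: (wN k Nk); apply: le_trans (wx k) _; rewrite lerD2r.
have -> : toC T ^+ k *m toC x = toC y - toC (y - T ^+ k *m x).
  by rewrite map_mxB map_mxM map_mx_expr subKr.
rewrite mulmxBr (le_trans (ler_normB _ _)) // lerD2l.
rewrite (le_trans (mulmx_norm_le _ _)) // -[leRHS]mulr1 ler_wpM2l ?mulr_ge0 //.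
by rewrite (le_trans (toC_norm_le _)) // (lecR _ 1) ltW.
Qed.

End RealToComplex.

(** * Powers and the spectral radius *)

Section PowerBound.
Variable K : numFieldType.

(** The recursion [A ^+ n.+1 Y = l (A ^+ n Y) + A ^+ n (A - l) Y] preserves the bound as soon as
    [|l| k' + k <= c k']. *)
Lemma expr_norm_le_factor (q : nat) (A Y : 'M[K]_q) (l c k : K) :
  0 <= c -> `|l| < c -> 0 <= k ->
  (forall n, `|A ^+ n *m ((A - l%:M) *m Y)| <= k * c ^+ n) ->
  exists2 k', 0 <= k' & forall n, `|A ^+ n *m Y| <= k' * c ^+ n.
Proof.
move=> c0 lc k0 Ak; have cl : 0 < c - `|l| by rewrite subr_gt0.
have kcl : 0 <= k / (c - `|l|) by rewrite divr_ge0 // ltW.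
(* The first summand settles [n = 0], the second gives [k <= k' (c - |l|)]. *)
exists (`|Y| + k / (c - `|l|)); first by rewrite addr_ge0.
set k' := _ + _; have k'0 : 0 <= k' by rewrite addr_ge0.
have kk' : k <= k' * (c - `|l|).
  by rewrite -ler_pdivrMr // lerDr.
elim=> [|n IH]; first by rewrite !expr0 mul1mx mulr1 lerDl.
have -> : A ^+ n.+1 *m Y = l *: (A ^+ n *m Y) + A ^+ n *m ((A - l%:M) *m Y).
  rewrite mulmxBl mulmxBr mul_scalar_mx -scalemxAr addrC subrK.
  by rewrite exprSr -mulmxE -mulmxA.
apply: le_trans (ler_normD _ _) _; rewrite normrZ.
apply: (@le_trans _ _ (`|l| * (k' * c ^+ n) + k' * (c - `|l|) * c ^+ n)).
  apply: lerD; first by rewrite ler_wpM2l.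
  by apply: le_trans (Ak n) _; rewrite ler_wpM2r // exprn_ge0.
by rewrite exprS le_eqVlt; apply/orP; left; apply/eqP; ring.
Qed.

Lemma expr_norm_le_prod (q : nat) (A Y : 'M[K]_q.+1) (s : seq K) (c k : K) :
  0 <= c -> (forall z, z \in s -> `|z| < c) -> 0 <= k ->
  (forall n, `|A ^+ n *m (\prod_(z <- s) (A - z%:M) *m Y)| <= k * c ^+ n) ->
  exists2 k', 0 <= k' & forall n, `|A ^+ n *m Y| <= k' * c ^+ n.
Proof.
move=> c0; elim: s k => [|z s IH] k sc k0 Ak.
  by exists k => // n; have := Ak n; rewrite big_nil mul1mx.
have [|k' k'0 Ak'] := @expr_norm_le_factor _ A (\prod_(z <- s) (A - z%:M) *m Y)
  z c k c0 (sc z (mem_head _ _)) k0.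
  by move=> n; have := Ak n; rewrite big_cons -mulmxE -mulmxA.
by apply: IH Ak' => // t ts; apply: sc; rewrite inE ts orbT.
Qed.

End PowerBound.

(** By Cayley-Hamilton the product of all factors [A - z] is 0, which is trivially bounded; the
    factors are then removed one at a time. No Jordan form enters. *)
Lemma expr_norm_le_eigenvalue (K : numClosedFieldType) (q : nat) (A : 'M[K]_q)
    (c : K) :
  0 <= c -> (forall z, eigenvalue A z -> `|z| < c) ->
  exists2 k, 0 <= k & forall n, `|A ^+ n| <= k * c ^+ n.
Proof.
case: q A => [|q] A c0 Ac.
  exists 0 => // n; rewrite mul0r.
  have -> : A ^+ n = 0 by apply/matrixP => -[].
  by rewrite normr0.
have [s sE] := closed_field_poly_normal (char_poly A).
rewrite (monicP (char_poly_monic A)) scale1r in sE.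
have [|||k k0 Ak] := @expr_norm_le_prod _ q A 1%:M s c 0 c0.
- move=> z zs; apply: Ac.
  by rewrite eigenvalue_root_char sE root_prod_XsubC.
- by [].
- have : \prod_(z <- s) (A - z%:M) = 0.
    rewrite -[RHS](Cayley_Hamilton A) sE rmorph_prod; apply: eq_bigr => z _.
    by rewrite rmorphB /= horner_mx_X horner_mx_C.
  by move=> -> n; rewrite mul0mx mulmx0 normr0 mul0r.
by exists k => // n; have := Ak n; rewrite mulmx1.
Qed.

Section SpectralRadius.
Variable R : realType.

Lemma powR_inv_cvg1 (x : R) : 0 < x -> x `^ (n%:R^-1) @[n --> \oo] --> (1 : R).
Proof.
move=> x0; rewrite /powR gt_eqF // -[X in _ --> X]expR0; apply: continuous_cvg.
  exact: continuous_expR.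
rewrite -(mul0r (ln x)); apply: cvgMl.
by rewrite -(cvg_shiftS (fun n => n%:R^-1 : R)); apply: cvg_harmonic.
Qed.

(** The n-th roots of the constants [k] and [q] tend to 1, so the upper bounds for every [c] above
    [r] and the lower bound squeeze the limit to [r]. *)
Lemma root_cvg (a : nat -> R) (r q : R) :
  (forall n, 0 <= a n) -> 0 <= r -> 0 < q ->
  (forall n, (0 < n)%N -> r ^+ n <= q * a n) ->
  (forall c, r < c -> exists2 k, 0 < k & forall n, a n <= k * c ^+ n) ->
  a n `^ (n%:R^-1) @[n --> \oo] --> r.
Proof.
move=> a0 r0 q0 ra ac; apply/cvgrPdist_lt => e e0.
have powK (c : R) n : 0 <= c -> (0 < n)%N -> (c ^+ n) `^ (n%:R^-1) = c.
  move=> c0 n0; rewrite -powR_mulrn // -powRrM divff ?powRr1 //.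
  by rewrite pnatr_eq0 -lt0n.
have inv0 n : (0 : R) <= n%:R^-1 by rewrite invr_ge0.
have c0 : r < r + e / 2 by rewrite ltrDl divr_gt0.
have c1 : 0 <= r + e / 2 by apply: le_trans r0 (ltW c0).
have [k k0 ak] := ac _ c0.
have upper : k `^ (n%:R^-1) * (r + e / 2) @[n --> \oo] --> 1 * (r + e / 2).
  by apply: cvgMl; apply: powR_inv_cvg1.
have lower : (q `^ (n%:R^-1)) * (r - e) @[n --> \oo] --> 1 * (r - e).
  by apply: cvgMl; apply: powR_inv_cvg1.
near=> n.
have n0 : (0 < n)%N by near: n; exact: nbhs_infty_gt.
have Un : a n `^ (n%:R^-1) <= k `^ (n%:R^-1) * (r + e / 2).
  rewrite -[X in _ * X](powK _ n) // -powRM ?exprn_ge0 ?(ltW k0) //.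
  by apply: ge0_ler_powR; rewrite ?nnegrE ?mulr_ge0 ?exprn_ge0 // ltW.
have Ln : r <= q `^ (n%:R^-1) * a n `^ (n%:R^-1).
  rewrite -[leLHS](powK _ n) // -powRM ?(ltW q0) //.
  by apply: ge0_ler_powR; rewrite ?nnegrE ?ra // ?mulr_ge0 ?exprn_ge0 // ltW.
have Un' : k `^ (n%:R^-1) * (r + e / 2) < r + e.
  near: n; apply: (cvgr_lt _ upper).
  by rewrite mul1r ltrD2l ltr_pdivrMr // ltr_pMr // ltr1n.
have Ln' : q `^ (n%:R^-1) * (r - e) < r.
  by near: n; apply: (cvgr_lt _ lower); rewrite mul1r ltrBlDr ltrDl.
rewrite ltr_distlC; apply/andP; split; last exact: le_lt_trans Un Un'.
by rewrite -(ltr_pM2l (powR_gt0 (n%:R^-1) q0)); apply: lt_le_trans Ln' Ln.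
Unshelve. all: by end_near. Qed.

Lemma ReK (V : normedZmodType R[i]) (x : V) : (complex.Re `|x|)%:C%C = `|x|.
Proof. by rewrite RRe_real // normr_real. Qed.

(** [r] is the largest modulus in the finite spectrum, as a real number; the alternative [r = 0]
    accounts for an empty spectrum. *)
Lemma spectral_bound (q : nat) (A : 'M[R[i]]_q) :
  (forall z, eigenvalue A z -> `|z| < 1) ->
  exists (r : R), [/\ 0 <= r, r < 1, forall z, eigenvalue A z -> `|z| <= r%:C%C
    & r = 0 \/ exists2 z, eigenvalue A z & `|z| = r%:C%C].
Proof.
move=> A1; have [s sE] := closed_field_poly_normal (char_poly A).
rewrite (monicP (char_poly_monic A)) scale1r in sE.
have As z : eigenvalue A z = (z \in s).
  by rewrite eigenvalue_root_char sE root_prod_XsubC.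
have {sE A1} : forall z, z \in s -> `|z| < 1 by move=> z; rewrite -As; apply: A1.
suff H : (forall z, z \in s -> `|z| < 1) -> exists r : R, [/\ 0 <= r, r < 1,
    forall z, z \in s -> `|z| <= r%:C%C & r = 0 \/ exists2 z, z \in s & `|z| = r%:C%C].
  move=> /H [r [r0 r1 rs rz]]; exists r; split=> // [z|]; first by rewrite As; apply: rs.
  by case: rz => [|[z zs zr]]; [left|right; exists z; rewrite ?As].
elim: s {As} => [|z s IH] s1; first by exists 0; split=> //; left.
have [|r [r0 r1 rs rz]] := IH; first by move=> t ts; apply: s1; rewrite inE ts orbT.
have z1 := s1 z (mem_head _ _).
have [zr|zr] := lerP (complex.Re `|z|) r.
  exists r; split=> // [t|].
    by rewrite inE => /orP [/eqP ->|]; [rewrite -ReK lecR|apply: rs].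
  by case: rz => [|[t ts tr]]; [left|right; exists t; rewrite ?inE ?ts ?orbT].
exists (complex.Re `|z|); split.
- by rewrite -ler0c ReK.
- by rewrite -ltcR ReK.
- move=> t; rewrite inE => /orP [/eqP ->|ts]; first by rewrite ReK.
  by apply: le_trans (rs t ts) _; rewrite lecR ltW.
- by right; exists z; rewrite ?mem_head ?ReK.
Qed.

Lemma spectral_radius_lt1 (q : nat) (A : 'M[R[i]]_q) :
  (forall z, eigenvalue A z -> `|z| < 1) -> spectral_radius A < 1.
Proof.
move=> /spectral_bound [r [r0 r1 Ar rA]].
suff lr : complex.Re `|A ^+ n| `^ (n%:R^-1) @[n --> \oo] --> r.
  by rewrite /spectral_radius (cvg_lim _ lr).
(* An eigenvector [v] of modulus [r] gives [r ^+ n |v| <= q |A ^+ n| |v|]; the successor keeps the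
   constant positive when [q = 0]. *)
apply: (@root_cvg _ _ q.+1%:R) => //.
- by move=> n; rewrite -ler0c ReK.
- move=> n n0; have [->|[z /eigenvalueP [v vA v0] zr]] := rA.
    by rewrite expr0n gtn_eqF //= mulr_ge0 // -ler0c ReK.
  have vAn : v *m A ^+ n = z ^+ n *: v.
    elim: n {n0} => [|n IH]; first by rewrite !expr0 mulmx1 scale1r.
    by rewrite exprS -mulmxE mulmxA vA -scalemxAl IH scalerA -exprS.
  have v1 : 0 < `|v| by rewrite normr_gt0.
  rewrite -lecR rmorphXn rmorphM /= ReK -zr -normrX -(ler_pM2r v1) -normrZ -vAn.
  apply: le_trans (mulmx_norm_le _ _) _; rewrite rmorph_nat mulrAC.
  by rewrite ler_wpM2r // ler_wpM2r // ler_nat.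
move=> c rc; have c0 : 0 <= c%:C%C :> R[i] by rewrite ler0c (le_trans r0) // ltW.
have [z Az|k k0 Ak] := expr_norm_le_eigenvalue (A := A) c0.
  by apply: le_lt_trans (Ar z Az) _; rewrite ltcR.
have kE : (complex.Re k)%:C%C = k by rewrite RRe_real // ger0_real.
exists (complex.Re k + 1).
  by rewrite ltr_wpDl // -ler0c kE.
move=> n; apply: (@le_trans _ _ (complex.Re k * c ^+ n)).
  by rewrite -lecR ReK rmorphM rmorphXn /= kE.
by rewrite ler_wpM2r ?lerDl // exprn_ge0 // -ler0c.
Qed.

End SpectralRadius.

(** * Splitting off unimodular eigenvalues *)

(** Either [v] lies in the row space of [A - l], or some column of the cokernel pairs nontrivially
    with [v]; such a column is a right eigenvector. *)
Lemma left_eigenvector_dichotomy (F : fieldType) (n : nat) (A : 'M[F]_n) (l : F)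
    (v : 'rV[F]_n) :
  v != 0 -> v *m A = l *: v ->
  (exists u, u *m A = l *: u + v) \/
  (exists w : 'cV[F]_n, A *m w = l *: w /\ v *m w = 1%:M).
Proof.
move=> v0 vA; pose G := A - l%:M.
have [/submxP [u vu]|] := boolP (v <= G)%MS.
  left; exists u; have -> : u *m A = u *m G + l *: u.
    by rewrite mulmxBr mul_mx_scalar subrK.
  by rewrite -vu addrC.
rewrite submxE => /matrix0Pn [i [j vj]]; right.
set a := (v *m cokermx G) i j in vj; exists (a^-1 *: col j (cokermx G)).
have Gw : G *m col j (cokermx G) = 0 by rewrite colE mulmxA mulmx_coker mul0mx.
split; rewrite -scalemxAr.
  rewrite scalerA mulrC -scalerA; congr (_ *: _); rewrite -mul_scalar_mx.
  by apply/eqP; rewrite -subr_eq0 -mulmxBl Gw.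
rewrite colE mulmxA -colE; apply/matrixP => s t.
by rewrite mxE [in LHS]mxE [RHS]mxE !ord1 eqxx mulr1n -[RHS](mulVf vj) /a ord1.
Qed.

Section Splitting.
Variable K : numFieldType.

(** Multiplication by the injective [Q] lifts left eigenvectors and Jordan chains of the
    complementary block to [A]. *)
Lemma mx_iso_left_eigen (m k n : nat) (A : 'M[K]_m) (D : 'M[K]_k)
    (A' : 'M[K]_n) :
  mx_iso A (block_mx D 0 0 A') ->
  exists Q : 'M[K]_(n, m), row_free Q /\ Q *m A = A' *m Q.
Proof.
move=> /mx_iso_sym [P [Q [PQ QP DP]]]; exists (dsubmx P); split.
  apply/row_freeP; exists (rsubmx Q).
  have := congr1 (@drsubmx _ k n k n) PQ.
  by rewrite -{1}(vsubmxK P) -{1}(hsubmxK Q) mul_col_row block_mxKdr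
    scalar_mx_block block_mxKdr.
have := congr1 (@dsubmx _ k n m) DP.
rewrite -{1 2}(vsubmxK P) mul_block_col mul_col_mx !col_mxKd mul0mx add0r.
by move=> ->.
Qed.

Lemma expansive_block (m k n : nat) (A : 'M[K]_m) (D : 'M[K]_k) (A' : 'M[K]_n) :
  mx_iso A (block_mx D 0 0 A') -> expansive A' -> expansive A.
Proof.
move=> /mx_iso_left_eigen [Q [Qf QA]] [l [u [v [v0 vA lA]]]].
exists l, (u *m Q), (v *m Q); split.
- by rewrite mulmx_free_eq0.
- by rewrite -mulmxA QA mulmxA vA scalemxAl.
case: lA => [l1|[l1 uA]]; [by left|right; split=> //].
by rewrite -mulmxA QA mulmxA uA mulmxDl scalemxAl.
Qed.

Lemma eigenvalue_block (m k n : nat) (A : 'M[K]_m) (D : 'M[K]_k) (A' : 'M[K]_n)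
    (z : K) :
  mx_iso A (block_mx D 0 0 A') -> eigenvalue A' z -> eigenvalue A z.
Proof.
move=> /mx_iso_left_eigen [Q [Qf QA]] /eigenvalueP [v vA v0].
apply/eigenvalueP; exists (v *m Q); last by rewrite mulmx_free_eq0.
by rewrite -mulmxA QA mulmxA vA scalemxAl.
Qed.

End Splitting.

(** * Real blocks from complex eigenvectors *)

Section RealSplitting.
Variable R : realType.
Local Notation toC := (map_mx (real_complex R)).
Local Notation ReM := (map_mx (@complex.Re R)).
Local Notation ImM := (map_mx (@complex.Im R)).

Lemma map_block_diag (m n : nat) (A : 'M[R]_m) (B : 'M[R]_n) :
  toC (block_mx A 0 0 B) = block_mx (toC A) 0 0 (toC B).
Proof. by rewrite map_block_mx !map_mx0. Qed.

Lemma split_real_eigenvalue (n : nat) (T : 'M[R]_n) (l : R) :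
  ~ expansive (toC T) -> `|l| = 1 -> eigenvalue (toC T) l%:C%C ->
  exists m (T' : 'M[R]_m), mx_iso T (block_mx (l%:M : 'M[R]_1) 0 0 T').
Proof.
move=> nT l1 /eigenvalueP [v vT v0].
(* For a real eigenvalue the real and imaginary parts of [v] are again eigenvectors or zero, and not
   both are zero. *)
have [v1 v1T v10] : exists2 v1 : 'rV[R]_n, v1 *m T = l *: v1 & v1 != 0.
  have [vr|vr] := eqVneq (ReM v) 0; [exists (ImM v)|exists (ReM v) => //].
  - by rewrite -ImM_mulmxr vT ImM_scale /= scale0r addr0.
  - by apply: contra_neq v0; apply: complex_mx_eq0.
  - by rewrite -ReM_mulmxr vT ReM_scale /= scale0r subr0.
have [[u uT]|[w [Tw vw]]] := left_eigenvector_dichotomy v10 v1T.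
  exfalso; apply: nT; exists l%:C%C, (toC u), (toC v1); split.
  - by apply: contra_neq v10 => v10; rewrite -(ReM_toC v1) v10; apply/matrixP => i j; rewrite !mxE.
  - by rewrite -map_mxM v1T map_mxZ.
  - right; split; first by rewrite normc_def /= expr0n addr0 sqrtr_sqr l1.
    by rewrite -map_mxM uT map_mxD map_mxZ.
apply: (mx_iso_split vw); first by rewrite mul_scalar_mx.
by rewrite mul_mx_scalar.
Qed.

Lemma unit_circle_angle (a b : R) :
  a ^+ 2 + b ^+ 2 = 1 ->
  exists t : R, [/\ 0 <= t < 2 * pi, cos t = a & sin t = b].
Proof.
move=> ab; have a1 : -1 <= a <= 1.
  by rewrite -ler_norml -(expr_le1 (n := 2)) // real_normK ?num_real // -ab lerDl sqr_ge0.
have bE : Num.sqrt (1 - a ^+ 2) = `|b| by rewrite -ab addrC addKr sqrtr_sqr.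
have pi0 := pi_gt0 R.
have t0 := acos_ge0 a1; have tpi := acos_lepi a1.
have cosa : cos (acos a) = a by rewrite acosK // in_itv.
have sina : sin (acos a) = `|b| by rewrite sin_acos.
have [b0|b0] := lerP 0 b.
  exists (acos a); split=> //; last by rewrite sina ger0_norm.
  by apply/andP; split=> //; lra.
exists (2 * pi - acos a); split.
(* Since [sin] is nonzero at [acos a], the angle [2 * pi - acos a] is strictly below [2 * pi]. *)
- have : acos a != 0.
    by apply/eqP => a0; move: sina; rewrite a0 sin0 => /esym/eqP; rewrite normr_eq0 lt_eqF.
  move=> a0; have {}t0 : 0 < acos a by rewrite lt0r a0.
  by apply/andP; split; lra.
- by rewrite -[RHS]cosa mulr_natl addrC cosD2pi cosN.
- by rewrite mulr_natl addrC sinD2pi sinN sina ltr0_norm ?opprK.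
Qed.

Lemma rotationE (t : R) :
  rotation t = block_mx (cos t)%:M (- sin t)%:M (sin t)%:M (cos t)%:M :> 'M[R]_(1 + 1).
Proof.
apply/matrixP => i j; rewrite block_mxEv !mxE.
case: splitP => i' ii; rewrite !mxE; case: splitP => j' jj; rewrite !mxE !ord1 /=;
  by rewrite -!val_eqE /= ii jj !ord1 mulr1n.
Qed.

Lemma split_rotation (n : nat) (T : 'M[R]_n) (z : R[i]) :
  ~ expansive (toC T) -> `|z| = 1 -> complex.Im z != 0 -> eigenvalue (toC T) z ->
  exists (t : R) m (T' : 'M[R]_m),
    0 <= t < 2 * pi /\ mx_iso T (block_mx (rotation t) 0 0 T').
Proof.
move=> nT z1 zi /eigenvalueP [v vT v0].
have [[u uT]|[w0 [Tw0 vw0]]] := left_eigenvector_dichotomy v0 vT.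
  by exfalso; apply: nT; exists z, u, v; split=> //; right.
(* The pairing is normalized to 2, so that the real and imaginary parts of [v] and [w] pair to 1 and
   -1. *)
have [w Tw vw] : exists2 w, toC T *m w = z *: w & v *m w = 2%:M.
  exists (2 *: w0); first by rewrite -scalemxAr Tw0 !scalerA mulrC.
  by rewrite -scalemxAr vw0 scale_scalar_mx mulr1.
pose v' := map_mx (@conjc R) v.
have v'T : v' *m toC T = conjc z *: v'.
  have -> : toC T = map_mx (@conjc R) (toC T).
    by apply/matrixP => i j; rewrite !mxE conjc_real.
  by rewrite -map_mxM vT map_mxZ.
(* The conjugate [v'] and [w] belong to the distinct eigenvalues [conjc z] and [z], hence pair to
   0. *)
have v'w : v' *m w = 0.
  have : conjc z *: (v' *m w) = z *: (v' *m w).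
    by rewrite scalemxAl -v'T -mulmxA Tw scalemxAr.
  move/eqP; rewrite -subr_eq0 -scalerBl scaler_eq0 => /orP [|/eqP //].
  case: (z) zi => a b /= b0; rewrite eq_complex /= => /andP [_].
  by rewrite -opprD oppr_eq0 -mulr2n mulrn_eq0 (negPf b0).
have v'r : ReM v' = ReM v by apply/matrixP => i j; rewrite !mxE; case: (v i j).
have v'i : ImM v' = - ImM v by apply/matrixP => i j; rewrite !mxE; case: (v i j).
have H1 := congr1 ReM vw; have H2 := congr1 ImM vw.
have H3 := congr1 ReM v'w; have H4 := congr1 ImM v'w.
rewrite !(ReM_mul, ImM_mul) ?v'r ?v'i in H1 H2 H3 H4.
have [t [tpi ca sb]] : exists t : R,
    [/\ 0 <= t < 2 * pi, cos t = complex.Re z & sin t = complex.Im z].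
  apply: unit_circle_angle; have := add_Re2_Im2 z; rewrite z1 expr1n.
  by move=> /(congr1 (@complex.Re R)).
exists t.
suff [m [T' TT']] : exists m (T' : 'M[R]_m), mx_iso T (block_mx (rotation t) 0 0 T').
  by exists m, T'.
(* From [v w = 2] and [v' w = 0]: the real parts pair to 1, the imaginary parts to -1, mixed pairs
   to 0; hence the sign in [- ImM w]. *)
apply: (@mx_iso_split _ _ _ _ _ (col_mx (ReM v) (ImM v)) (row_mx (ReM w) (- ImM w))).
- rewrite mul_col_row scalar_mx_block.
  rewrite !mulmxN; move: H1 H2 H3 H4; rewrite !mulNmx.
  move: (ReM v *m ReM w) (ReM v *m ImM w) (ImM v *m ReM w) (ImM v *m ImM w).
  move=> p q r s /matrixP /(_ 0 0) H1 /matrixP /(_ 0 0) H2 /matrixP /(_ 0 0) H3.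
  move=> /matrixP /(_ 0 0) H4; rewrite !mxE /= in H1 H2 H3 H4.
  congr block_mx; apply/matrixP => i j; rewrite !mxE !ord1 /=; lra.
- rewrite rotationE mul_col_mx mul_block_col !mul_scalar_mx ca sb.
  by rewrite -ReM_mulmxr -ImM_mulmxr vT ReM_scale ImM_scale scaleNr [X in col_mx _ X]addrC.
- rewrite rotationE mul_mx_row mul_row_block !mul_mx_scalar ca sb.
  rewrite mulmxN -ReM_mulmxl -ImM_mulmxl Tw ReM_scale ImM_scale.
  by congr row_mx; rewrite scalerN // opprD scaleNr addrC.
Qed.

End RealSplitting.

(** * Iterated splitting by induction on the dimension *)

Section Decomposition.
Variable R : realType.
Local Notation toC := (map_mx (real_complex R)).

Lemma decompose_rotations (n : nat) (T : 'M[R]_n) :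
  ~ expansive (toC T) ->
  exists (k m : nat) (t : 'I_k -> R) (T' : 'M[R]_m),
    [/\ forall i, 0 <= t i < 2 * pi,
        mx_iso T (block_mx (\mxdiag_(i < k) rotation (t i)) 0 0 T'),
        ~ expansive (toC T') &
        forall z, `|z| = 1 -> eigenvalue (toC T') z -> complex.Im z = 0].
Proof.
elim/ltn_ind: n T => n IH T nT.
have [[z [z1 zT zi]]|Tz] := pselect (exists z : R[i],
    [/\ `|z| = 1, eigenvalue (toC T) z & complex.Im z != 0]); last first.
  exists 0, n, (fun=> 0), T; split=> //.
  - by case.
  - by apply/mx_iso_sym/mx_iso_block0; rewrite big_ord0.
  - by move=> z z1 zT; apply/eqP/negP => /negP zi; apply: Tz; exists z.
have [t0 [m [T1 [t0pi TT1]]]] := split_rotation nT z1 zi zT.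
(* A growing left chain of the complement would lift to [T], so the induction hypothesis applies. *)
have nT1 : ~ expansive (toC T1).
  move=> eT1; apply: nT; have := mx_iso_map (real_complex R) TT1.
  by rewrite map_block_diag => /expansive_block; apply.
have mn : (m < n)%N by rewrite (mx_iso_size TT1) ltnS leqnSn.
have [k [m' [t [T2 [tpi T12 nT2 T2z]]]]] := IH m mn T1 nT1.
exists k.+1, m', (fun i => if unlift ord0 i is Some j then t j else t0), T2.
split=> // [i|]; first by case: unliftP.
apply: mx_iso_trans TT1 _.
apply: mx_iso_trans (mx_iso_block (mx_iso_refl _) T12) _.
apply: mx_iso_trans (mx_iso_blockA _ _ _) _.
apply: mx_iso_block (mx_iso_refl _).
rewrite mxdiag_recl unlift_none.
have -> : \mxdiag_(i < k) rotation (if unlift ord0 (lift ord0 i) is Some j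
    then t j else t0) = \mxdiag_(i < k) rotation (t i).
  by apply: eq_mxdiag => i; rewrite liftK.
exact: mx_iso_cast.
Qed.

Lemma decompose_involution (n : nat) (T : 'M[R]_n) :
  ~ expansive (toC T) ->
  (forall z, `|z| = 1 -> eigenvalue (toC T) z -> complex.Im z = 0) ->
  exists (p q : nat) (B : 'M[R]_p) (C : 'M[R]_q),
    [/\ mx_iso T (block_mx B 0 0 C), B ^+ 2 = 1%:M &
        forall z, eigenvalue (toC C) z -> `|z| < 1].
Proof.
elim/ltn_ind: n T => n IH T nT Tz.
have [[z [z1 zT]]|Tlt] := pselect (exists z : R[i],
    ~~ (`|z| < 1) /\ eigenvalue (toC T) z); last first.
  exists 0, n, (0 : 'M[R]_0), T; split=> //.
  - exact/mx_iso_sym/mx_iso_block0.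
  - by apply/matrixP => -[].
  - by move=> z zT; apply/negP => /negP z1; apply: Tlt; exists z.
(* A modulus above 1 would make [T] expansive; [v] fills the irrelevant place of [u]. *)
have {}z1 : `|z| = 1.
  apply/eqP; move: z1; rewrite -real_leNgt ?normr_real ?real1 // le_eqVlt eq_sym.
  case/orP => // z1; exfalso; apply: nT.
  have [v vT v0] := eigenvalueP zT.
  by exists z, v, v; split=> //; left.
pose l := complex.Re z; have zE : z = l%:C%C.
  by move: (Tz z z1 zT); rewrite /l; case: (z) => a b /= ->.
have l1 : `|l| = 1.
  move: z1; rewrite zE normc_def /= expr0n addr0 sqrtr_sqr.
  by move=> /(congr1 (@complex.Re R)).
rewrite zE in zT.
have [m [T1 TT1]] := split_real_eigenvalue nT l1 zT.
have TC := mx_iso_map (real_complex R) TT1; rewrite map_block_diag in TC.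
have nT1 : ~ expansive (toC T1) by move=> eT1; apply/nT/(expansive_block TC).
have mn : (m < n)%N by rewrite (mx_iso_size TT1).
have [|p [q [B [C [T1BC B2 Cz]]]]] := IH m mn T1 nT1.
  by move=> y y1 yT1; apply: Tz y1 (eigenvalue_block TC yT1).
exists (1 + p)%N, q, (block_mx (l%:M : 'M[R]_1) 0 0 B), C; split=> //.
  apply: mx_iso_trans TT1 _; apply: mx_iso_trans (mx_iso_blockA _ _ _).
  exact: mx_iso_block (mx_iso_refl _) T1BC.
rewrite block_diag_expr B2 scalar_mx_block; congr block_mx.
by rewrite expr2 -mulmxE -scalar_mxM -expr2 -real_normK ?num_real // l1 expr1n.
Qed.

Lemma norm_expr_lt (q : nat) (C : 'M[R]_q) :
  (forall z, eigenvalue (toC C) z -> `|z| < 1) ->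
  forall e : R, 0 < e -> exists N, forall n, (N <= n)%N -> `|C ^+ n| < e.
Proof.
move=> /spectral_bound [r [r0 r1 Cr _]] e e0.
(* Any rate strictly between the largest modulus [r] and 1 gives geometric decay. *)
pose c := (1 + r) / 2.
have [c0 c1 rc] : [/\ 0 <= c, c < 1 & r < c].
  by rewrite /c; split; lra.
have c0C : 0 <= c%:C%C :> R[i] by rewrite ler0c.
have [z Cz|k k0 Ck] := expr_norm_le_eigenvalue (A := toC C) c0C.
  by apply: le_lt_trans (Cr z Cz) _; rewrite ltcR.
pose k' := complex.Re k.
have kE : k'%:C%C = k by rewrite RRe_real // ger0_real.
have k'0 : 0 <= k' by rewrite -ler0c kE.
have Ck' n : `|C ^+ n| <= k' * c ^+ n.
  apply: mx_norm_le => [|i j]; first by rewrite mulr_ge0 // exprn_ge0.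
  rewrite -lecR rmorphM rmorphXn /= kE; apply: le_trans (Ck n).
  rewrite -map_mx_expr; apply: le_trans (mx_entry_le_norm _ i j).
  by rewrite mxE normc_def /= expr0n addr0 sqrtr_sqr.
have c1' : `|c| < 1 by rewrite ger0_norm.
have /cvgrPdist_lt /(_ e e0) [N _ NC] := cvg_geometric k' c1'.
exists N => n Nn; have := NC n Nn; rewrite sub0r normrN; apply: le_lt_trans.
by apply: le_trans (Ck' n) (ler_norm _).
Qed.

End Decomposition.

(** * Reduction to the normal form *)

Theorem theorem7 (R : realType) (N : nat) (hN : (1 <= N)%N) (T : 'M[R]_N) :
  ~ orbit_reflexive T <->
  exists T' : 'M[R]_N,
    [/\ T ~_{in unitmx} T',
        ~ orbit_reflexive T'
      & rotation_involution_contraction_form T'].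
Proof.
split=> [nT|[T' [/mx_iso_simmx TT' nT' _] rT]]; last first.
  exact/nT'/(orbit_reflexive_iso TT').
have nexp : ~ expansive (map_mx (real_complex R) T).
  by move=> /expansive_orbit_reflexive.
have [k [m [t [T1 [tpi TT1 nT1 T1z]]]]] := decompose_rotations nexp.
have [p [q [B [C [T1BC B2 Cz]]]]] := decompose_involution nT1 T1z.
have TD := mx_iso_trans TT1 (mx_iso_block (mx_iso_refl _) T1BC).
have k0 : (1 <= k)%N.
  (* Without rotations [T] would be similar to an involution plus a contraction, hence orbit
     reflexive. *)
  rewrite lt0n; apply/eqP => k0; apply: nT.
  have TBC : mx_iso T (mx_dsum B C).
    by apply: mx_iso_trans TD (mx_iso_block0 _ _ _); rewrite k0 big_ord0.
  apply: (orbit_reflexive_iso (mx_iso_sym TBC)).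
  apply: orbit_reflexive_involution_contraction => //.
    by rewrite -(mx_iso_size TBC).
  exact: norm_expr_lt.
have {}TD := mx_iso_trans TD (mx_iso_blockA _ _ _).
have e := esym (mx_iso_size TD).
have TT' := mx_iso_trans TD (mx_iso_cast e _).
exists (castmx (e, e)
  (mx_dsum (mx_dsum (\mxdiag_(i < k) rotation (t i)) B) C)); split.
- exact/mx_iso_simmx.
- by move=> rT'; apply/nT/(orbit_reflexive_iso (mx_iso_sym TT')).
- exists k, p, q, t, B, C, e; split=> //; exact: spectral_radius_lt1.
Qed.
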